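(* Let $n \geq 2$ and let $G$ be a finite simple graph on $n$ vertices. For $i = 0, 1, \ldots, n-1$ define the vector $\mathbf{x}_i \in \mathbb{R}^n$ by: $\mathbf{x}_0 = (1,1,\ldots,1)^T$, and for $1 \leq i \leq n-1$, the $j$-th entry of $\mathbf{x}_i$ is $-1$ if $1 \leq j \leq i$, is $i$ if $j = i+1$, and is $0$ if $j \geq i+2$. Then there exists a labelling $v_1, v_2, \ldots, v_n$ of the vertex set of $G$ such that every vector $\mathbf{x}_0, \mathbf{x}_1, \ldots, \mathbf{x}_{n-1}$ is an eigenvector of the Laplacian matrix $L(G)$ (written with respect to this labelling) if and only if $G$ is a threshold graph.
   Context: The Laplacian matrix of $G$ with respect to a labelling $v_1,\ldots,v_n$ is $L(G) = D(G) - A(G)$, where $A(G)$ is the adjacency matrix ($A_{ij}=1$ if $v_i, v_j$ are adjacent and $0$ otherwise) and $D(G)$ is the diagonal matrix with $D_{ii}$ equal to the degree of $v_i$. A threshold graph is a graph that can be constructed starting from a single isolated vertex by successively adding vertices, each new vertex being either an isolated vertex (adjacent to none of the previous vertices) or a dominating vertex (adjacent to all previous vertices); equivalently, a graph containing no induced subgraph isomorphic to $P_4$, $C_4$, or $2K_2$. *)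

(* Defs.v *)
From mathcomp Require Import all_boot all_order all_algebra.

Set Implicit Arguments.
Unset Strict Implicit.
Unset Printing Implicit Defensive.

Import GRing.Theory.
Local Open Scope ring_scope.

(* A finite simple graph is a symmetric irreflexive relation e on a finType T.
   A labelling of its vertices is a bijection v : 'I_n -> T; the vertex v_k of
   the text is v (k - 1), since labels start at 0 here. *)

Section Laplacian.
Variables (R : nzRingType) (T : finType) (e : rel T).

Definition degree (u : T) : nat := #|[set w | e u w]|.

Variables (n : nat) (v : 'I_n -> T).

Definition adjacency_mx : 'M[R]_n := \matrix_(i, j) (e (v i) (v j))%:R.

Definition degree_mx : 'M[R]_n := diag_mx (\row_i (degree (v i))%:R).

Definition laplacian_mx : 'M[R]_n := degree_mx - adjacency_mx.

End Laplacian.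

(* Column-vector eigenvectors; mathcomp's eigenspace is about row vectors. *)
Definition is_eigenvector (F : fieldType) (n : nat) (A : 'M[F]_n)
    (x : 'cV[F]_n) : Prop :=
  x != 0 /\ exists a : F, A *m x = a *: x.

(* The row index j stands for the (j+1)-st entry, so the conditions j <= i and
   j = i + 1 on 1-based positions become j < i and j = i. *)
Definition xvec (R : nzRingType) (n : nat) (i : 'I_n) : 'cV[R]_n :=
  \col_(j < n) if i == 0%N :> nat then 1
               else if (j < i)%N then -1
               else if j == i then i%:R
               else 0.

(* threshold_on e A: the subgraph induced by e on A can be built from a single
   vertex by successively adding isolated or dominating vertices. *)
Inductive threshold_on (T : finType) (e : rel T) : {set T} -> Prop :=
| threshold_single (u : T) : threshold_on e [set u]
| threshold_isolated (A : {set T}) (u : T) :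
    threshold_on e A -> u \notin A -> (forall w, w \in A -> ~~ e u w) ->
    threshold_on e (u |: A)
| threshold_dominating (A : {set T}) (u : T) :
    threshold_on e A -> u \notin A -> (forall w, w \in A -> e u w) ->
    threshold_on e (u |: A).

Definition threshold (T : finType) (e : rel T) : Prop :=
  threshold_on e [set: T].

(* Main.v *)
(** Both sides are equivalent to the existence of a labelling in which every
    vertex v_k is adjacent to all or to none of its predecessors.  Row r > k
    of [L x_k = a x_k] says that k A_rk is the sum of the A_rj over j < k, and
    since the entries are 0 or 1 this forces A_rj = A_rk for all j < k.
    Conversely, if v_k has adjacency s_k to its predecessors, then x_k is an
    eigenvector for the eigenvalue (k + 1) s_k + sum_(j > k) s_j. *)
Require Import Defs.
From mathcomp Require Import all_boot all_order all_algebra.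
From mathcomp Require Import ring.

Set Implicit Arguments.
Unset Strict Implicit.
Unset Printing Implicit Defensive.

Import Order.TTheory GRing.Theory Num.Theory.
Local Open Scope ring_scope.

Definition constant_below (T : finType) (e : rel T) n (v : 'I_n -> T) :=
  forall i j k : 'I_n, (i < k)%N -> (j < k)%N -> e (v k) (v i) = e (v k) (v j).

(** List form of the same condition, since a construction sequence grows by appending at the end.
    The default [x0] is arbitrary because all three positions lie within [s]. *)
Definition constant_below_seq (T : eqType) (e : rel T) (s : seq T) :=
  forall x0 i j k, (i < k)%N -> (j < k)%N -> (k < size s)%N ->
    e (nth x0 s k) (nth x0 s i) = e (nth x0 s k) (nth x0 s j).

Lemma threshold_on_seq (T : finType) (e : rel T) (A : {set T}) :
  threshold_on e A ->
  exists s : seq T, [/\ uniq s, s =i A & constant_below_seq e s].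
Proof.
(* Isolated and dominating vertices are handled together: [b] is the common adjacency of [u] to the
   vertices of [B], and [u] goes last in the list. *)
have extend (B : {set T}) u b :
    (exists s : seq T, [/\ uniq s, s =i B & constant_below_seq e s]) ->
    u \notin B -> (forall w, w \in B -> e u w = b) ->
    exists s : seq T, [/\ uniq s, s =i u |: B & constant_below_seq e s].
  move=> [s [s_uniq sB s_const]] uNB u_const.
  exists (rcons s u); split=> [|w|x0 i j k ltik ltjk].
  - by rewrite rcons_uniq sB uNB.
  - by rewrite mem_rcons !inE sB.
  rewrite size_rcons ltnS leq_eqVlt => /predU1P[k_eq | ltks].
    rewrite k_eq in ltik ltjk *.
    rewrite !nth_rcons ltnn eqxx ltik ltjk.
    by rewrite !u_const // -sB mem_nth.
  rewrite !nth_rcons ltks (ltn_trans ltik ltks) (ltn_trans ltjk ltks).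
  exact: s_const.
elim=> [u | B u _ IH uNB isol | B u _ IH uNB dom].
- exists [:: u]; split=> // [w|x0 i j [|k]] //; first by rewrite !inE.
- by apply: (extend _ _ false) => // w /isol/negPf.
- exact: (extend _ _ true).
Qed.

Lemma threshold_constant_below (T : finType) (e : rel T) n :
  (0 < n)%N -> #|T| = n ->
  threshold e <-> exists v : 'I_n -> T, bijective v /\ constant_below e v.
Proof.
case: n => // n _ cardT.
split=> [/threshold_on_seq[s [s_uniq sT s_const]] | [v [v_bij v_const]]].
  have size_s : size s = n.+1.
    by rewrite -cardT -(card_uniqP s_uniq) (eq_card sT) cardsT.
  case: s => // x0 s' in s_uniq sT s_const size_s *.
  exists (fun i => nth x0 (x0 :: s') i); split.
    apply: inj_card_bij => [i j /eqP|]; last by rewrite card_ord cardT.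
    by rewrite nth_uniq ?size_s // => /eqP/val_inj.
  by move=> i j k ltik ltjk; apply: s_const; rewrite ?size_s.
(* Induction over initial segments of the labelling; the construction starts from the single vertex
   [v ord0]. *)
have initial m : (m <= n)%N -> threshold_on e (v @: [set i : 'I_n.+1 | i <= m]%N).
  elim: m => [_ | m IH ltmn].
    suff -> : [set i : 'I_n.+1 | i <= 0]%N = [set ord0].
      by rewrite imset_set1; apply: threshold_single.
    by apply/setP=> i; rewrite !inE leqn0.
  pose k := Ordinal (ltmn : (m.+1 < n.+1)%N).
  have -> : [set i : 'I_n.+1 | i <= m.+1]%N = k |: [set i : 'I_n.+1 | i <= m]%N.
    by apply/setP=> i; rewrite !inE leq_eqVlt.
  rewrite imsetU1.
  have kN : v k \notin v @: [set i : 'I_n.+1 | i <= m]%N.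
    by rewrite mem_imset ?inE ?ltnn //; exact: bij_inj.
  (* The adjacency of [v k] to the first vertex decides whether it is added as dominating or as
     isolated. *)
  have k_const w : w \in v @: [set i : 'I_n.+1 | i <= m]%N ->
      e (v k) w = e (v k) (v ord0).
    by case/imsetP=> i; rewrite inE => leim ->; apply: v_const.
  case ek0 : (e (v k) (v ord0)) in k_const.
    by apply: threshold_dominating => //; apply: IH; apply: ltnW.
  by apply: threshold_isolated => [||w /k_const->] //; apply: IH; apply: ltnW.
rewrite /threshold; suff -> : [set: T] = v @: [set i : 'I_n.+1 | i <= n]%N.
  exact: initial.
case: v_bij => g _ vg; apply/esym/setP=> x; rewrite inE -[x]vg imset_f //.
by rewrite inE -ltnS.
Qed.

(** For 0 < k these are the ranges on which the entries of [xvec R k] are -1, k and 0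
    respectively. *)
Lemma big_ord_split3 (V : nmodType) n (k : 'I_n) (F : 'I_n -> V) :
  \sum_j F j = \sum_(j < n | (j < k)%N) F j + F k + \sum_(j < n | (k < j)%N) F j.
Proof.
rewrite (bigID (fun j : 'I_n => (j < k)%N)) /= -addrA; congr (_ + _).
rewrite (bigD1 k) ?ltnn //=; congr (_ + _); apply: eq_bigl => j.
by rewrite -leqNgt andbC ltn_neqAle eq_sym.
Qed.

Lemma sumr_const_lt (V : nmodType) n (k : 'I_n) (x : V) :
  \sum_(j < n | (j < k)%N) x = x *+ k.
Proof.
by rewrite -(big_ord_widen _ (fun=> x) (ltnW (ltn_ord k))) sumr_const card_ord.
Qed.

Section Eigenvectors.
Variables (R : realFieldType) (T : finType) (e : rel T) (n : nat).
Variable v : 'I_n -> T.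
Hypothesis v_bij : bijective v.

Let A (i j : 'I_n) : R := (e (v i) (v j))%:R.

(** The degree of [v r] is the sum of row r of [A], by reindexing along the bijection [v]. In this
    form equal entries of [x] cancel. *)
Lemma laplacian_mulE (x : 'cV[R]_n) r :
  (laplacian_mx R e v *m x) r 0 = \sum_j A r j * (x r 0 - x j 0).
Proof.
have -> : \sum_j A r j * (x r 0 - x j 0)
    = (\sum_j A r j) * x r 0 - \sum_j A r j * x j 0.
  by rewrite mulr_suml -sumrB; apply: eq_bigr => j _; rewrite mulrBr.
have -> : \sum_j A r j = (degree e (v r))%:R.
  rewrite /degree -sum1_card natr_sum (reindex v) /=; last exact: onW_bij.
  by rewrite [RHS]big_mkcond; apply: eq_bigr => j _; rewrite inE /A; case: ifP.
rewrite mulmxBl mxE [in RHS]addrC [LHS]addrC; congr (_ + _).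
  by rewrite !mxE; congr (- _); apply: eq_bigr => j _; rewrite !mxE.
by rewrite mul_diag_mx !mxE.
Qed.

Lemma xvec0 (k j : 'I_n) : k = 0%N :> nat -> xvec R k j 0 = 1.
Proof. by rewrite mxE => ->. Qed.

Lemma xvec_lt (k j : 'I_n) : (j < k)%N -> xvec R k j 0 = -1.
Proof. by rewrite mxE; case: (val k) => //= k' ->. Qed.

Lemma xvec_eq (k : 'I_n) : (0 < k)%N -> xvec R k k 0 = k%:R.
Proof. by rewrite lt0n mxE ltnn eqxx => /negPf->. Qed.

Lemma xvec_gt (k j : 'I_n) : (0 < k)%N -> (k < j)%N -> xvec R k j 0 = 0.
Proof.
rewrite lt0n mxE => /negPf-> ltkj.
by rewrite ltnNge (ltnW ltkj) -val_eqE /= gtn_eqF.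
Qed.

Lemma eigenvector_xvec_constant_below :
  (forall k, is_eigenvector (laplacian_mx R e v) (xvec R k)) ->
  constant_below e v.
Proof.
move=> eig.
have row (i k r : 'I_n) : (i < k)%N -> (k < r)%N ->
    e (v r) (v i) = e (v r) (v k).
  move=> ltik ltkr; have k_gt0 : (0 < k)%N by exact: leq_ltn_trans ltik.
  have [_ [a /(congr1 (fun M : 'cV_n => M r 0))]] := eig k.
  rewrite laplacian_mulE [RHS]mxE xvec_gt // mulr0 (big_ord_split3 k) xvec_eq //.
  rewrite [X in _ + X]big1 => [|j ltkj]; last by rewrite xvec_gt // subr0 mulr0.
  under eq_bigr => j ltjk do rewrite xvec_lt // sub0r opprK mulr1.
  rewrite sub0r addr0 mulrN mulr_natr -sumr_const_lt -sumrB => sum0.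
  (* The differences [A r j - A r k] all have the same sign: nonnegative if [A r k] is 0,
     nonpositive if it is 1. Up to sign their sum counts the disagreements, so its vanishing leaves
     none. *)
  have {}sum0 : \sum_(j < n | (j < k)%N) (e (v r) (v j) != e (v r) (v k))%:R = 0 :> R.
    case erk : (e (v r) (v k)).
      rewrite -[RHS]oppr0 -[in RHS]sum0 -sumrN; apply: eq_bigr => j _.
      by rewrite /A erk; case: (e _ _); rewrite /= ?subrr ?sub0r ?opprK ?oppr0.
    rewrite -[RHS]sum0; apply: eq_bigr => j _.
    by rewrite /A erk subr0; case: (e _ _).
  have /(_ i ltik)/eqP := psumr_eq0P (fun j _ => ler0n _ _) sum0.
  by rewrite pnatr_eq0 eqb0 negbK => /eqP.
(* Of two distinct predecessors of k, the larger one indexes the eigenvector, which is read in row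
   k. *)
move=> i j k ltik ltjk; have [ltij | ltji | /val_inj-> //] := ltngtP i j.
  exact: row.
exact/esym/row.
Qed.

Hypothesis e_sym : symmetric e.

Lemma constant_below_eigenvector_xvec (k : 'I_n) :
  constant_below e v -> is_eigenvector (laplacian_mx R e v) (xvec R k).
Proof.
move=> v_const; case: (posnP k) => [k0 | k_gt0].
  split; first by apply/eqP=> /matrixP/(_ k 0)/eqP; rewrite xvec0 // mxE oner_eq0.
  exists 0; apply/matrixP=> r c; rewrite ord1 laplacian_mulE scale0r [RHS]mxE.
  by apply: big1 => j _; rewrite !xvec0 // subrr mulr0.
have n_gt0 : (0 < n)%N by exact: leq_ltn_trans (ltn_ord k).
(* The first label stands for all predecessors: for j > 0, [A j o] is the common entry s_j of row j
   left of the diagonal. *)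
pose o := Ordinal n_gt0.
have AE (i j : 'I_n) : (j < i)%N -> A i j = A i o.
  move=> ltji; congr (_%:R); congr nat_of_bool; apply: v_const => //.
  exact: leq_ltn_trans ltji.
have AC i j : A i j = A j i by rewrite /A e_sym.
split.
  apply/eqP=> /matrixP/(_ k 0)/eqP.
  by rewrite xvec_eq // mxE pnatr_eq0 -leqn0 leqNgt k_gt0.
exists (k.+1%:R * A k o + \sum_(j < n | (k < j)%N) A j o).
apply/matrixP=> r c; rewrite ord1 laplacian_mulE [RHS]mxE (big_ord_split3 k).
rewrite (xvec_eq k_gt0).
under eq_bigr => j ltjk do rewrite (xvec_lt ltjk).
under [X in _ + X]eq_bigr => j ltkj do rewrite (xvec_gt k_gt0 ltkj) subr0.
rewrite -natr1.
(* For r < k, symmetry turns the entries in columns j >= k into s_j, and the row gives minus the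
   eigenvalue. For r > k, the k copies of s_r cancel against -k s_r. For r = k, the two sums are k
   (k + 1) s_k and k times the sum of the s_j over j > k. *)
case: (ltngtP r k) => [ltrk | ltkr | /val_inj->].
- rewrite xvec_lt // -mulr_suml subrr mulr0 AC AE //.
  under eq_bigr => j ltkj do rewrite AC (AE _ _ (ltn_trans ltrk ltkj)).
  by rewrite -mulr_suml; ring.
- under eq_bigr => j ltjk do rewrite (AE _ _ (ltn_trans ltjk ltkr)).
  rewrite xvec_gt // -!mulr_suml !mulr0.
  by rewrite sumr_const_lt AE // -mulr_natr; ring.
rewrite xvec_eq //.
under eq_bigr => j ltjk do rewrite (AE _ _ ltjk).
under [X in _ + X]eq_bigr => j ltkj do rewrite AC (AE _ _ ltkj).
by rewrite sumr_const_lt -mulr_suml -mulr_natr; ring.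
Qed.

End Eigenvectors.

Theorem theorem3p3 (R : realFieldType) (n : nat) (hn : (2 <= n)%N)
    (T : finType) (e : rel T) (e_sym : symmetric e) (e_irr : irreflexive e)
    (cardT : #|T| = n) :
  (exists v : 'I_n -> T, bijective v /\
     forall i : 'I_n, is_eigenvector (laplacian_mx R e v) (xvec R i))
  <-> threshold e.
Proof.
rewrite (threshold_constant_below e (ltnW hn) cardT).
split=> -[v [v_bij vP]]; exists v; split=> //.
  exact: eigenvector_xvec_constant_below vP.
by move=> i; apply: constant_below_eigenvector_xvec.
Qed.
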